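(* Let $\mu$ be the Gibbs distribution of a $q$-state spin system. If $\mu$ is $\kappa$-contractive with respect to a $\Phi$-local collection $\mathcal P$ of Markov chains associated with $\mu$ and a $\gamma$-equivalent metric $d$, for some $\kappa\in(0,1)$, then $\mu$ is spectrally independent with constant $\eta=\frac{2\gamma^2\Phi}{1-\kappa}$.
   Context: Spin system. Let $q\ge2$, $[q]=\{1,\dots,q\}$, and let $G=(V\cup\partial V,E\cup\partial E)$ be a finite graph, where $\partial V$ is a (possibly empty) boundary set, $E$ is the set of edges inside $V$ and $\partial E$ the set of edges between $V$ and $\partial V$. Given nonnegative symmetric matrices $A_{xy}\in\mathbb R_+^{q\times q}$ for $\{x,y\}\in E\cup\partial E$, vectors $B_x\in\mathbb R_+^q$ for $x\in V$, and a boundary condition $\xi\in[q]^{\partial V}$, a configuration $\sigma\in[q]^V$ has weight $w(\sigma)=\prod_{\{x,y\}\in E}A_{xy}(\sigma_x,\sigma_y)\prod_{\{x,y\}\in\partial E,\,x\in V,\,y\in\partial V}A_{xy}(\sigma_x,\xi_y)\prod_{x\in V}B_x(\sigma_x)$. Let $\Omega=\{\sigma:w(\sigma)>0\}$ (assumed nonempty); the Gibbs distribution is $\mu(\sigma)\propto w(\sigma)$ on $\Omega$. Pinnings. For $U\subset V$, $\Omega_U$ is the set of $\tau\in[q]^U$ that extend to an element of $\Omega$; $\mathcal T=\bigcup_{U\subset V}\Omega_U$. For $\tau\in\Omega_U$, $\mu^\tau=\mu(\cdot\mid\sigma_U=\tau)$ with support $\Omega^\tau$; $\Omega_x^\tau$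 is the set of spins possible at $x$ under $\mu^\tau$; $\mathcal X^\tau=\{(x,a):x\in V\setminus U,a\in\Omega^\tau_x\}$. Standing assumption: $\mu$ is totally-connected, i.e. for every pinning $\tau$ the set $\Omega^\tau$ is connected under moves between configurations at Hamming distance 1. Spectral independence. $J^\tau\in\mathbb R^{\mathcal X^\tau\times\mathcal X^\tau}$ has entries $J^\tau(x,a;x,a')=0$ and $J^\tau(x,a;y,a')=\mu^\tau(\sigma_y=a'\mid\sigma_x=a)-\mu^\tau(\sigma_y=a')$ for $x\neq y$; its eigenvalues are real. $\mu$ is spectrally independent with constant $\eta$ if the largest eigenvalue satisfies $\lambda_1(J^\tau)\le\eta$ for all $\tau\in\mathcal T$. Collection of chains. $\mathcal P=\{P^\tau:\tau\in\mathcal T\}$, where $P^\tau$ is a Markov chain on $\Omega^\tau$ with stationary distribution $\mu^\tau$. $\mathcal P$ is $\Phi$-local if for any $\tau\in\mathcal T$, any $(x,a)\in\mathcal X^\tau$, with $\tau'=\tau\cup(x,a)$ the pinning combining $\tau$ and $\sigma_x=a$, and all $\sigma\in\Omega^{\tau'}$, one has $W_{1,d_{\mathrm H}}(P^\tau(\sigma,\cdot),P^{\tau'}(\sigma,\cdot))\le\Phi$. Here $d_{\mathrm H}(\sigma,\tau)=|\{x\in V:\sigma_x\ne\tau_x\}|$ and $W_{1,d}(\mu_1,\mu_2)=\inf_\pi\mathbb E_\pi[d(\sigma,\tau)]$ over couplings $\pi$ of $\mu_1,\mu_2$. Contraction. $\mu$ is $\kappa$-contractive w.r.t. $\mathcal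 P$ and a metric $d$ on $\Omega$ if for all $\tau\in\mathcal T$ and all $X_0,Y_0\in\Omega^\tau$ there is a coupling $(X_0,Y_0)\to(X_1,Y_1)$ of one step of $P^\tau$ with $\mathbb E[d(X_1,Y_1)\mid X_0,Y_0]\le\kappa\,d(X_0,Y_0)$. For $\gamma\ge1$, $d$ is $\gamma$-equivalent if $\frac1\gamma d_{\mathrm H}\le d\le\gamma d_{\mathrm H}$ on $\Omega\times\Omega$. *)

(* Defs.v *)
From HB Require Import structures.
From mathcomp Require Import all_boot all_order all_algebra.
From mathcomp Require Import boolp classical_sets reals.
Set Implicit Arguments.
Unset Strict Implicit.
Unset Printing Implicit Defensive.
Import Order.TTheory GRing.Theory Num.Theory.
Local Open Scope ring_scope.

Definition is_distr (R : realType) (T : finType) (m : T -> R) :=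
  (forall s, 0 <= m s) /\ \sum_s m s = 1.

Section FiniteDistributions.
Variables (R : realType) (T : finType).
Implicit Types (m : T -> R) (E : pred T) (pi : T * T -> R) (d : T -> T -> R).

Definition Pr m E : R := \sum_(s | E s) m s.

(* The law m( . | E); only meaningful when 0 < Pr m E. *)
Definition cond m E : T -> R := fun s => if E s then m s / Pr m E else 0.

Definition supp m : {set T} := [set s | 0 < m s].

Definition coupling m1 m2 pi :=
  [/\ is_distr pi,
      forall s, \sum_t pi (s, t) = m1 s
    & forall t, \sum_s pi (s, t) = m2 t].

Definition expect_dist pi d : R := \sum_p pi p * d p.1 p.2.

Definition W1 d m1 m2 : R :=
  inf [set r | exists2 pi, coupling m1 m2 pi & r = expect_dist pi d]%classic.

Definition metric_on (A : {set T}) d :=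
  [/\ {in A &, forall s t, 0 <= d s t},
      {in A &, forall s t, d s t = 0 <-> s = t},
      {in A &, forall s t, d s t = d t s}
    & {in A & &, forall s t u, d s u <= d s t + d t u}].

End FiniteDistributions.

(* V is the set of interior vertices and bV the boundary; spins are 'I_q.
   The edge sets E and \partial E are given by the relations edge and bedge.
   The interaction matrices are only constrained along the edges, and are
   attached to unordered edges, whence interaction_edge_sym. *)
Record spin_system (R : realType) (q : nat) (V bV : finType) := SpinSystem {
  edge : rel V;
  edge_sym : symmetric edge;
  edge_irr : irreflexive edge;
  bedge : V -> bV -> bool;
  interaction : V -> V -> 'M[R]_q;
  interaction_edge_sym : forall x y, edge x y -> interaction y x = interaction x y;
  interaction_sym : forall x y, edge x y -> (interaction x y)^T = interaction x y;
  interaction_ge0 : forall x y, edge x y -> forall a b, 0 <= interaction x y a b;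
  binteraction : V -> bV -> 'M[R]_q;
  binteraction_sym : forall x y, bedge x y -> (binteraction x y)^T = binteraction x y;
  binteraction_ge0 : forall x y, bedge x y -> forall a b, 0 <= binteraction x y a b;
  ext_field : V -> 'I_q -> R;
  ext_field_ge0 : forall x a, 0 <= ext_field x a;
  bcond : {ffun bV -> 'I_q}
}.

Definition config (q : nat) (V : finType) := {ffun V -> 'I_q}.

(* An element tau of [q]^U, for some subset U of V, is encoded as a partial
   function on V, with U = dom tau. *)
Definition partial (q : nat) (V : finType) := {ffun V -> option 'I_q}.

Section SpinSystems.
Variables (R : realType) (q : nat) (V bV : finType).
Variable S : spin_system R q V bV.
Implicit Types (s t : config q V) (tau : partial q V) (x y : V) (a : 'I_q).

Definition hamming s t : nat := #|[set x | s x != t x]|.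

Definition hammingR s t : R := (hamming s t)%:R.

(* The condition on ranks selects one orientation of each edge {x, y}; the
   factor does not depend on this choice, by interaction_edge_sym and interaction_sym. *)
Definition weight s : R :=
  (\prod_(p : V * V | edge S p.1 p.2 && (enum_rank p.1 < enum_rank p.2)%N)
     interaction S p.1 p.2 (s p.1) (s p.2)) *
  (\prod_(p : V * bV | bedge S p.1 p.2)
     binteraction S p.1 p.2 (s p.1) (bcond S p.2)) *
  \prod_x ext_field S x (s x).

Definition Omega : {set config q V} := [set s | 0 < weight s].

Definition gibbs s : R := weight s / \sum_t weight t.

Definition dom tau : {set V} := [set x | tau x != None].

Definition extends tau : pred (config q V) :=
  fun s => [forall x in dom tau, tau x == Some (s x)].

Definition is_pinning tau : Prop := exists2 s, s \in Omega & extends tau s.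

Definition pin tau x a : partial q V :=
  [ffun y => if y == x then Some a else tau y].

Definition gibbs_pin tau : config q V -> R := cond gibbs (extends tau).

Definition Omega_pin tau : {set config q V} := supp (gibbs_pin tau).

Definition spin_at x a : pred (config q V) := fun s => s x == a.

Definition spins tau x : {set 'I_q} :=
  [set a | 0 < Pr (gibbs_pin tau) (spin_at x a)].

Definition Xset tau : {set V * 'I_q} :=
  [set p | (p.1 \notin dom tau) && (p.2 \in spins tau p.1)].

Definition totally_connected : Prop :=
  forall tau, is_pinning tau ->
  {in Omega_pin tau &, forall s t,
     connect [rel u v | [&& u \in Omega_pin tau, v \in Omega_pin tau
                          & hamming u v == 1%N]] s t}.

Definition influence tau (p r : V * 'I_q) : R :=
  if p.1 == r.1 then 0
  else Pr (cond (gibbs_pin tau) (spin_at p.1 p.2)) (spin_at r.1 r.2)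
       - Pr (gibbs_pin tau) (spin_at r.1 r.2).

Definition influence_mx tau : 'M[R]_#|Xset tau| :=
  \matrix_(i, j) influence tau (enum_val i) (enum_val j).

(* The diagonal matrix D with entries Pr (gibbs_pin tau) (spin_at x a) > 0 is
   such that D *m influence_mx tau is symmetric, so that all the complex
   eigenvalues of influence_mx tau lie in R. The largest one is bounded by eta
   iff all of them are; there is none if Xset tau is empty. *)
Definition spectrally_independent (eta : R) : Prop :=
  forall tau, is_pinning tau ->
  forall lambda : R, eigenvalue (influence_mx tau) lambda -> lambda <= eta.

(* P tau s t is the transition probability from s to t of the chain for tau;
   it is irrelevant unless tau is a pinning and s is in Omega_pin tau. *)
Definition chains := partial q V -> config q V -> config q V -> R.

Definition markov_chain_on (A : {set config q V})
    (K : config q V -> config q V -> R) : Prop :=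
  {in A, forall s, is_distr (K s) /\ (forall t, t \notin A -> K s t = 0)}.

Definition stationary (A : {set config q V})
    (K : config q V -> config q V -> R) (m : config q V -> R) : Prop :=
  {in A, forall t, \sum_(s in A) m s * K s t = m t}.

Definition chain_collection (P : chains) : Prop :=
  forall tau, is_pinning tau ->
  markov_chain_on (Omega_pin tau) (P tau) /\
  stationary (Omega_pin tau) (P tau) (gibbs_pin tau).

Definition local_collection (Phi : R) (P : chains) : Prop :=
  forall tau, is_pinning tau ->
  forall x a, (x, a) \in Xset tau ->
  {in Omega_pin (pin tau x a), forall s,
     W1 hammingR (P tau s) (P (pin tau x a) s) <= Phi}.

Definition contractive (kappa : R) (P : chains)
    (d : config q V -> config q V -> R) : Prop :=
  forall tau, is_pinning tau ->
  {in Omega_pin tau &, forall s t,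
     exists2 pi, coupling (P tau s) (P tau t) pi
               & expect_dist pi d <= kappa * d s t}.

Definition hamming_equivalent (gamma : R)
    (d : config q V -> config q V -> R) : Prop :=
  {in Omega &, forall s t,
     gamma^-1 * hammingR s t <= d s t <= gamma * hammingR s t}.

End SpinSystems.

(* Main.v *)
Require Import Defs.
From HB Require Import structures.
From mathcomp Require Import all_boot all_order all_algebra.
From mathcomp Require Import boolp classical_sets reals.
From mathcomp Require Import lra.
Set Implicit Arguments.
Unset Strict Implicit.
Unset Printing Implicit Defensive.
Import Order.TTheory GRing.Theory Num.Theory.
Local Open Scope ring_scope.

(** The matrix [influence_mx tau] has absolute row sums at most
    eta = 2 gamma^2 Phi / (1 - kappa) ([influence_row_le]), and bounded absolute
    row sums bound every eigenvalue ([eigenvalue_le_row_sum]).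

    The row of (x, a) compares the one-vertex marginals of mu = mu^tau with
    those of mu' = mu^tau', where tau' = tau + (x, a).  Its absolute sum is
    mean mu f - mean mu' f for the function f that adds up the signs of the
    differences over the events sigma_y = b that hold; f changes by at most 2
    for each vertex whose spin changes, so it is 2-Lipschitz for the Hamming
    distance and 2 gamma-Lipschitz for d.

    It remains to bound mean mu f - mean mu' f for functions f that are
    1-Lipschitz for d.  Let D be the supremum of these differences.  By
    stationarity,
      mean mu f - mean mu' f
        = (mean mu (P^tau f) - mean mu' (P^tau f)) + mean mu' (P^tau f - P^tau' f).
    Contraction makes P^tau f kappa-Lipschitz, so the first term is at most
    kappa D; locality bounds the second one by gamma Phi, as f is
    gamma-Lipschitz for the Hamming distance.  Hence D <= kappa D + gamma Phi
    ([stationary_mean_diff_le]).  Working with Lipschitz test functions, only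
    the easy half of Kantorovich duality is needed ([mean_diff_le_coupling],
    [mean_diff_le_W1]), and optimal couplings never have to be glued. *)

(** * Means of Lipschitz functions and couplings *)

Section Means.
Variables (R : realType) (T : finType).
Implicit Types (m f : T -> R) (A : {set T}) (d : T -> T -> R).

(** The expectation of [f] under the law [m]. *)
Definition mean m f : R := \sum_s m s * f s.

(** The measure or function [m] vanishes outside [A]. *)
Definition vanishes_off A m := forall s, s \notin A -> m s = 0.

(** [f] is [L]-Lipschitz on [A]; as [d] is not assumed symmetric, the
    one-sided inequality is required for all ordered pairs. *)
Definition lipschitz_on A d (L : R) f :=
  {in A &, forall s t, f s - f t <= L * d s t}.

Lemma is_distr_coupling_prod m1 m2 :
  is_distr m1 -> is_distr m2 -> coupling m1 m2 (fun p => m1 p.1 * m2 p.2).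
Proof.
move=> [m1ge0 m1sum] [m2ge0 m2sum]; split => [|s|t].
- split => [p|]; first exact: mulr_ge0.
  rewrite -(pair_bigA _ (fun s t => m1 s * m2 t)) /= -[RHS]m1sum.
  by apply: eq_bigr => s _ /=; rewrite -mulr_sumr m2sum mulr1.
- by rewrite /= -mulr_sumr m2sum mulr1.
- by rewrite /= -mulr_suml m1sum mul1r.
Qed.

Lemma coupling_vanishes A m1 m2 pi s t :
  coupling m1 m2 pi -> vanishes_off A m1 -> vanishes_off A m2 ->
  ~~ ((s \in A) && (t \in A)) -> pi (s, t) = 0.
Proof.
move=> [[pi_ge0 _] pi1 pi2] m1A m2A; rewrite negb_and => /orP[sA|tA].
- by apply: (psumr_eq0P (P := xpredT) _ (etrans (pi1 s) (m1A s sA))).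
- by apply: (psumr_eq0P (P := xpredT) (F := fun u => pi (u, t)) _ (etrans (pi2 t) (m2A t tA))).
Qed.

Lemma mean_diff_coupling m1 m2 pi f : coupling m1 m2 pi ->
  mean m1 f - mean m2 f = \sum_p pi p * (f p.1 - f p.2).
Proof.
move=> [_ pi1 pi2].
have sum_pair g : \sum_p pi p * g p = \sum_s \sum_t pi (s, t) * g (s, t).
  by rewrite pair_bigA; apply: eq_bigr => -[].
have -> : mean m1 f = \sum_p pi p * f p.1.
  by rewrite sum_pair; apply: eq_bigr => s _; rewrite -pi1 mulr_suml.
have -> : mean m2 f = \sum_p pi p * f p.2.
  by rewrite sum_pair exchange_big; apply: eq_bigr => t _; rewrite -pi2 mulr_suml.
by rewrite -sumrB; apply: eq_bigr => p _; rewrite mulrBr.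
Qed.

Lemma mean_diff_le_coupling A d L m1 m2 pi f :
  coupling m1 m2 pi -> vanishes_off A m1 -> vanishes_off A m2 ->
  lipschitz_on A d L f -> mean m1 f - mean m2 f <= L * expect_dist pi d.
Proof.
move=> cpl m1A m2A flip; rewrite (mean_diff_coupling _ cpl) mulr_sumr.
apply: ler_sum => -[s t] _ /=.
have [/andP[sA tA]|nA] := boolP ((s \in A) && (t \in A)); last first.
  by rewrite (coupling_vanishes cpl m1A m2A nA) !mul0r mulr0.
have [[pi_ge0 _] _ _] := cpl.
by rewrite mulrCA ler_wpM2l// flip.
Qed.

Lemma mean_diff_le_W1 A d L m1 m2 f :
  0 < L -> is_distr m1 -> is_distr m2 ->
  vanishes_off A m1 -> vanishes_off A m2 ->
  lipschitz_on A d L f -> mean m1 f - mean m2 f <= L * W1 d m1 m2.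
Proof.
move=> L0 m1d m2d m1A m2A flip.
rewrite mulrC -ler_pdivrMr//; apply: lb_le_inf.
  by eexists; exists (fun p => m1 p.1 * m2 p.2); [exact: is_distr_coupling_prod|].
move=> _ [pi cpl ->]; rewrite ler_pdivrMr// mulrC.
exact: mean_diff_le_coupling m1A m2A flip.
Qed.

Lemma mean_Pr m (E : pred T) : mean m (fun s => (E s)%:R) = Pr m E.
Proof.
rewrite /mean /Pr [RHS]big_mkcond; apply: eq_bigr => s _.
by case: (E s); rewrite ?mulr1 ?mulr0.
Qed.

Lemma cond_is_distr m (E : pred T) :
  (forall s, 0 <= m s) -> 0 < Pr m E -> is_distr (cond m E).
Proof.
move=> m0 mE; split => [s|].
  by rewrite /cond; case: ifP => // _; rewrite divr_ge0// ltW.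
by rewrite -big_mkcond -mulr_suml divff// gt_eqF.
Qed.

Lemma cond_cond m (E F : pred T) : Pr m E != 0 ->
  cond (cond m E) F =1 cond m (fun s => E s && F s).
Proof.
move=> mE s.
have PrF : Pr (cond m E) F = Pr m (fun s => E s && F s) / Pr m E.
  rewrite /Pr /cond -big_mkcondr /= -mulr_suml; congr (_ / _).
  by apply: eq_bigl => t; rewrite andbC.
rewrite /cond -/(cond m E) PrF; case: (F s); case: (E s) => //=; last by rewrite mul0r.
by rewrite invf_div mulrA divfK.
Qed.

End Means.

Lemma eigenvalue_le_row_sum (R : realFieldType) (n : nat) (M : 'M[R]_n)
    (eta lambda : R) :
  (forall i, \sum_j `|M i j| <= eta) -> eigenvalue M lambda -> lambda <= eta.
Proof.
move=> rows /eigenvalueP[v vM v0].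
have norm_gt0 : 0 < \sum_j `|v 0 j|.
  rewrite lt_neqAle sumr_ge0 // andbT eq_sym; apply/negP => /eqP sum0.
  case/eqP: v0; apply/rowP => j; rewrite mxE; apply/eqP; rewrite -normr_eq0.
  by apply/eqP/(psumr_eq0P _ sum0).
suff : `|lambda| * (\sum_j `|v 0 j|) <= eta * \sum_j `|v 0 j|.
  by rewrite ler_pM2r//; apply: le_trans; apply: ler_norm.
(* The l^1 norm suits row vectors: eigenvectors act on the left. *)
have -> : `|lambda| * (\sum_j `|v 0 j|) = \sum_j `|\sum_i v 0 i * M i j|.
  rewrite mulr_sumr; apply: eq_bigr => j _; rewrite -normrM; congr `|_|.
  by move/rowP/(_ j): vM; rewrite !mxE.
apply: (@le_trans _ _ (\sum_j \sum_i `|v 0 i| * `|M i j|)).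
  apply: ler_sum => j _; apply: le_trans (ler_norm_sum _ _ _) _.
  by apply: ler_sum => i _; rewrite normrM.
rewrite exchange_big mulr_sumr; apply: ler_sum => i _.
by rewrite -mulr_sumr mulrC ler_wpM2r.
Qed.

(** * Comparing the stationary distributions of two chains *)

Section Stationary.
Variables (R : realType) (q : nat) (V : finType).
Implicit Types (A : {set config q V}) (K : config q V -> config q V -> R).
Implicit Types (m f : config q V -> R).

Lemma mean_stationary A K m f :
  markov_chain_on A K -> stationary A K m -> vanishes_off A m ->
  mean m f = mean m (fun s => mean (K s) f).
Proof.
move=> mc st mA.
have -> : mean m f = \sum_(t in A) (\sum_(s in A) m s * K s t) * f t.
  rewrite big_mkcond; apply: eq_bigr => t _; case: ifPn => tA; first by rewrite st.
  by rewrite mA// mul0r.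
under eq_bigr do rewrite mulr_suml.
rewrite exchange_big [RHS](bigID [in A]) /= [X in _ = _ + X]big1 ?addr0; last first.
  by move=> s sA; rewrite mA// mul0r.
apply: eq_bigr => s sA; rewrite /mean mulr_sumr big_mkcond; apply: eq_bigr => t _.
case: ifPn => tA; first by rewrite mulrA.
by have [_ KA] := mc s sA; rewrite KA// mul0r mulr0.
Qed.

(** If one step of [K] contracts [d] by [kappa], and the one-step means of
    1-Lipschitz functions under [K] and [K'] differ by at most [c], then their
    stationary means differ by at most the geometric sum c / (1 - kappa). *)
Lemma stationary_mean_diff_le A A' K K' m m' (d : config q V -> config q V -> R)
    (M kappa c : R) f :
  A' \subset A -> 0 < kappa < 1 ->
  markov_chain_on A K -> markov_chain_on A' K' ->
  is_distr m -> is_distr m' -> vanishes_off A m -> vanishes_off A' m' ->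
  stationary A K m -> stationary A' K' m' ->
  {in A &, forall s t, 0 <= d s t <= M} ->
  {in A &, forall s t, exists2 pi, coupling (K s) (K t) pi
                                 & expect_dist pi d <= kappa * d s t} ->
  (forall s g, s \in A' -> lipschitz_on A d 1 g ->
     mean (K s) g - mean (K' s) g <= c) ->
  lipschitz_on A d 1 f ->
  mean m f - mean m' f <= c / (1 - kappa).
Proof.
move=> AA /andP[k0 k1] mc mc' md md' mA mA' st st' dM contr loc flip.
have m'A : vanishes_off A m'.
  by move=> s sA; apply: mA'; apply: contra sA; apply: (fintype.subsetP AA).
pose D := [set r | exists2 g, lipschitz_on A d 1 g & r = mean m g - mean m' g]%classic.
have supD : has_sup D.
  split; first by exists (mean m f - mean m' f); exists f.
  exists M => _ [g glip ->].
  have cpl := is_distr_coupling_prod md md'.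
  (* On A, [g] is 1-Lipschitz for the constant distance M. *)
  have gM : lipschitz_on A (fun _ _ => M) 1 g.
    move=> s t sA tA; apply: le_trans (glip s t sA tA) _; rewrite !mul1r.
    by case/andP: (dM s t sA tA).
  have := mean_diff_le_coupling cpl mA m'A gM.
  by rewrite mul1r /expect_dist -mulr_suml; case: cpl => [[_ ->] _ _]; rewrite mul1r.
have leD g : lipschitz_on A d 1 g -> mean m g - mean m' g <= sup D.
  by move=> glip; apply: ub_le_sup; [case: supD|exists g].
suff : sup D <= c + kappa * sup D.
  move=> le_sup; apply: le_trans (leD f flip) _.
  by rewrite ler_pdivlMr ?subr_gt0// mulrBr mulr1; lra.
apply: ge_sup; first by case: supD.
(* By contraction, g |-> Kg / kappa preserves the 1-Lipschitz functions. *)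
move=> _ [g glip ->].
pose Kg s := mean (K s) g.
have Kglip : lipschitz_on A d 1 (fun s => kappa^-1 * Kg s).
  move=> s t sA tA; rewrite mul1r -mulrBr mulrC ler_pdivrMr// mulrC.
  have [pi cpl le_pi] := contr s t sA tA.
  apply: le_trans le_pi; rewrite -[X in _ <= X]mul1r.
  by apply: mean_diff_le_coupling cpl _ _ glip => u uA;
    [have [_ ->] := mc s sA | have [_ ->] := mc t tA].
have meanZ n : mean n (fun s => kappa^-1 * Kg s) = kappa^-1 * mean n Kg.
  by rewrite /mean mulr_sumr; apply: eq_bigr => s _; rewrite mulrCA.
have KgD : mean m Kg - mean m' Kg <= kappa * sup D.
  by have := leD _ Kglip; rewrite !meanZ -mulrBr mulrC ler_pdivrMr// mulrC.
rewrite (mean_stationary g mc st mA) (mean_stationary g mc' st' mA') -/Kg.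
have : mean m' Kg - mean m' (fun s => mean (K' s) g) <= c.
  have [m'0 m'1] := md'.
  rewrite -[X in _ <= X]mul1r -m'1 mulr_suml -sumrB; apply: ler_sum => s _.
  rewrite -mulrBr; have [sA'|sA'] := boolP (s \in A'); last by rewrite mA'// !mul0r.
  by rewrite ler_wpM2l// loc.
by lra.
Qed.

(** Each vertex whose spin differs changes the truth value of exactly two
    events of the form sigma_y = b. *)
Lemma lipschitz_hamming_spin_sum A (X : {set V * 'I_q}) (c : V * 'I_q -> R) :
  (forall p, `|c p| <= 1) ->
  lipschitz_on A (@hammingR R q V) 2
    (fun s => \sum_(p in X) c p * (spin_at p.1 p.2 s)%:R).
Proof.
move=> c1 s t _ _; rewrite -sumrB.
pose F (y : V) (b : 'I_q) : R := `|(s y == b)%:R - (t y == b)%:R|.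
apply: (@le_trans _ _ (\sum_p F p.1 p.2)).
  rewrite big_mkcond; apply: ler_sum => -[y b] _ /=.
  case: ifP => _; last exact: normr_ge0.
  rewrite -mulrBr; apply: le_trans (ler_norm _) _.
  by rewrite normrM ler_piMl.
rewrite -(pair_bigA _ F) /= /hammingR /hamming.
rewrite -sum1_card natr_sum mulr_sumr [X in _ <= X]big_mkcond.
apply: ler_sum => y _; rewrite inE /F; case: eqVneq => [->|st] /=.
  by rewrite big1// => b _; rewrite subrr normr0.
apply: (@le_trans _ _ (\sum_b ((s y == b)%:R + (t y == b)%:R))).
  by apply: ler_sum => b _; apply: le_trans (ler_normB _ _) _; rewrite !normr_nat.
have sum1 (a : 'I_q) : \sum_b (a == b)%:R = 1 :> R.
  rewrite (bigD1 a) //= eqxx big1 ?addr0// => b ba.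
  by rewrite eq_sym (negPf ba).
by rewrite big_split /= !sum1 mulr1.
Qed.

End Stationary.

(** * Pinned Gibbs distributions *)

Section Pinnings.
Variables (R : realType) (q : nat) (V bV : finType).
Variable S : spin_system R q V bV.
Implicit Types (s t : config q V) (tau : partial q V).

Lemma weight_ge0 s : 0 <= weight S s.
Proof.
rewrite /weight !mulr_ge0//; apply: prodr_ge0 => p.
- by case/andP => pe _; apply: interaction_ge0.
- by move=> pe; apply: binteraction_ge0.
- by move=> _; apply: ext_field_ge0.
Qed.

Lemma gibbs_ge0 s : 0 <= gibbs S s.
Proof. by rewrite divr_ge0 ?weight_ge0// sumr_ge0// => t _; apply: weight_ge0. Qed.

Lemma gibbs_gt0 s : (0 < gibbs S s) = (s \in Omega S).
Proof.
rewrite inE; have := weight_ge0 s; rewrite le_eqVlt => /orP[/eqP ws|ws].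
  by rewrite /gibbs -ws mul0r.
rewrite ws divr_gt0// (bigD1 s)//= ltr_pwDl//.
by rewrite sumr_ge0// => t _; apply: weight_ge0.
Qed.

Lemma Pr_gibbs_gt0 tau : is_pinning S tau -> 0 < Pr (gibbs S) (extends tau).
Proof.
move=> [s sO es]; rewrite /Pr (bigD1 s)//= ltr_pwDl ?gibbs_gt0//.
by rewrite sumr_ge0// => t _; apply: gibbs_ge0.
Qed.

Lemma gibbs_pin_is_distr tau : is_pinning S tau -> is_distr (gibbs_pin S tau).
Proof.
by move=> ptau; apply: cond_is_distr; [exact: gibbs_ge0|exact: Pr_gibbs_gt0].
Qed.

Lemma gibbs_pin_vanishes tau :
  is_pinning S tau -> vanishes_off (Omega_pin S tau) (gibbs_pin S tau).
Proof.
move=> ptau s; rewrite inE => ns; apply/eqP.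
have [/(_ s) ge0 _] := gibbs_pin_is_distr ptau.
by rewrite eq_le ge0 andbT leNgt.
Qed.

Lemma Omega_pinE tau s : is_pinning S tau ->
  (s \in Omega_pin S tau) = (s \in Omega S) && extends tau s.
Proof.
move=> ptau; rewrite inE /gibbs_pin /cond -gibbs_gt0.
case: ifP => _; last by rewrite ltxx andbF.
by rewrite pmulr_lgt0 ?invr_gt0 ?Pr_gibbs_gt0// andbT.
Qed.

Lemma extends_pin tau x a s : x \notin dom tau ->
  extends (pin tau x a) s = extends tau s && (s x == a).
Proof.
move=> xtau; apply/forall_inP/andP => [ext|[/forall_inP ext /eqP sx] y].
- split; last by have := ext x; rewrite inE ffunE eqxx /= eq_sym => /(_ isT).
  apply/forall_inP => y ytau.
  have yx : y != x by apply: contraNneq xtau => <-.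
  by have := ext y; rewrite inE ffunE (negPf yx); apply; rewrite inE in ytau.
- rewrite inE ffunE; case: (eqVneq y x) => [->|_] ytau; first by rewrite sx.
  by apply: ext; rewrite inE.
Qed.

Lemma is_pinning_pin tau x a : is_pinning S tau -> (x, a) \in Xset S tau ->
  is_pinning S (pin tau x a).
Proof.
move=> ptau; rewrite inE /= => /andP[xtau]; rewrite inE => Pr0.
have [s /andP[sO sx]|none] := pickP [pred s | (s \in Omega_pin S tau) && (s x == a)].
  exists s; move: sO; rewrite Omega_pinE// => /andP[sO sext] //.
  by rewrite extends_pin// sext.
move: Pr0; rewrite /Pr big1 ?ltxx// => s /eqP sx; apply: (gibbs_pin_vanishes ptau).
by apply/negP => sO; have := none s; rewrite /= sO sx eqxx.
Qed.

Lemma cond_gibbs_pin tau x a : is_pinning S tau -> x \notin dom tau ->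
  cond (gibbs_pin S tau) (spin_at x a) =1 gibbs_pin S (pin tau x a).
Proof.
move=> ptau xtau s; rewrite cond_cond ?gt_eqF ?Pr_gibbs_gt0//.
have -> : (fun s => extends tau s && spin_at x a s) = extends (pin tau x a).
  by apply/funext => t; rewrite extends_pin.
by [].
Qed.

Lemma Omega_pin_sub tau x a : is_pinning S tau -> (x, a) \in Xset S tau ->
  Omega_pin S (pin tau x a) \subset Omega_pin S tau.
Proof.
move=> ptau xaX; apply/fintype.subsetP => s.
have ptau' := is_pinning_pin ptau xaX.
have xtau : x \notin dom tau by move: xaX; rewrite inE => /andP[].
by rewrite !Omega_pinE// extends_pin// => /and3P[-> ->].
Qed.

(** The absolute row sum is a difference of means under the two pinned
    distributions, of the function weighing the events by the signs. *)
Lemma influence_row_mean tau x a : is_pinning S tau -> (x, a) \in Xset S tau ->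
  let f s := \sum_(p in Xset S tau)
    - Num.sg (influence S tau (x, a) p) * (spin_at p.1 p.2 s)%:R in
  \sum_(p in Xset S tau) `|influence S tau (x, a) p| =
  mean (gibbs_pin S tau) f - mean (gibbs_pin S (pin tau x a)) f.
Proof.
move=> ptau xaX f.
have xtau : x \notin dom tau by move: xaX; rewrite inE => /andP[].
have meanf m : mean m f = \sum_(p in Xset S tau)
    - Num.sg (influence S tau (x, a) p) * Pr m (spin_at p.1 p.2).
  rewrite /mean; under eq_bigr do rewrite mulr_sumr.
  rewrite exchange_big; apply: eq_bigr => p _.
  by rewrite -mean_Pr mulr_sumr; apply: eq_bigr => s _; rewrite mulrCA.
rewrite !meanf -sumrB; apply: eq_bigr => p _.
rewrite -mulrBr; have [xp|xp] := eqVneq x p.1.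
  have -> : influence S tau (x, a) p = 0 by rewrite /influence /= xp eqxx.
  by rewrite sgr0 normr0 oppr0 mul0r.
rewrite mulNr -mulrN opprB normrEsg; congr (_ * _).
by rewrite /influence /= (negPf xp) (funext (cond_gibbs_pin a ptau xtau)).
Qed.

End Pinnings.

(** * The row sum bound *)

Section RowBound.
Variables (R : realType) (q : nat) (V bV : finType).
Variable S : spin_system R q V bV.

Lemma influence_row_le (P : chains R q V) (d : config q V -> config q V -> R)
    (kappa Phi gamma : R) tau x a :
  chain_collection S P -> local_collection S Phi P ->
  1 <= gamma -> hamming_equivalent S gamma d ->
  0 < kappa < 1 -> contractive S kappa P d ->
  is_pinning S tau -> (x, a) \in Xset S tau ->
  \sum_(p in Xset S tau) `|influence S tau (x, a) p|
    <= 2 * gamma ^+ 2 * Phi / (1 - kappa).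
Proof.
move=> hP hPhi g1 hequiv hkappa hcontr ptau xaX.
have g0 : 0 < gamma by apply: lt_le_trans g1.
have ptau' := is_pinning_pin ptau xaX.
have sub := Omega_pin_sub ptau xaX.
have [mc st] := hP _ ptau; have [mc' st'] := hP _ ptau'.
rewrite influence_row_mean//; set f := fun s : config q V => _.
have equiv s t : s \in Omega_pin S tau -> t \in Omega_pin S tau ->
    gamma^-1 * hammingR R s t <= d s t <= gamma * hammingR R s t.
  by rewrite !Omega_pinE// => /andP[sO _] /andP[tO _]; apply: hequiv.
have flip : lipschitz_on (Omega_pin S tau) (@hammingR R q V) 2 f.
  apply: lipschitz_hamming_spin_sum => p; rewrite normrN normr_sg.
  by case: (_ != 0).
(* As d is at least 1 / gamma times the Hamming distance, [f] is
   2 gamma-Lipschitz for d. *)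
pose h s := (2 * gamma)^-1 * f s.
have g20 : 0 < 2 * gamma by rewrite mulr_gt0.
have hlip : lipschitz_on (Omega_pin S tau) d 1 h.
  move=> s t sO tO; rewrite mul1r -mulrBr mulrC ler_pdivrMr//.
  apply: le_trans (flip s t sO tO) _.
  have /andP[le_d _] := equiv s t sO tO.
  by rewrite mulrCA ler_pM2l// -ler_pdivrMr// mulrC.
have meanh m : mean m f = (2 * gamma) * mean m h.
  rewrite /mean mulr_sumr; apply: eq_bigr => s _.
  by rewrite /h mulrCA mulVKf// gt_eqF.
rewrite !meanh -mulrBr.
have -> : 2 * gamma ^+ 2 * Phi / (1 - kappa) = (2 * gamma) * (gamma * Phi / (1 - kappa)).
  by rewrite expr2 !mulrA.
rewrite ler_pM2l//.
apply: (stationary_mean_diff_le (M := gamma * #|V|%:R) sub hkappa mc mc'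
  (gibbs_pin_is_distr ptau) (gibbs_pin_is_distr ptau')
  (gibbs_pin_vanishes ptau) (gibbs_pin_vanishes ptau') st st' _ (hcontr _ ptau) _ hlip).
- move=> s t sO tO; have /andP[lo hi] := equiv s t sO tO.
  rewrite (le_trans _ lo) ?mulr_ge0 ?invr_ge0 ?ler0n ?(ltW g0)//=.
  by rewrite (le_trans hi)// ler_pM2l// ler_nat max_card.
- move=> s g sO' glip; have sO := fintype.subsetP sub s sO'.
  have [Kd Koff] := mc s sO; have [Kd' Koff'] := mc' s sO'.
  have Koff'' : vanishes_off (Omega_pin S tau) (P (pin tau x a) s).
    by move=> t tO; apply: Koff'; apply: contra tO; apply: fintype.subsetP.
  have glipH : lipschitz_on (Omega_pin S tau) (@hammingR R q V) gamma g.
    move=> u v uO vO; apply: le_trans (glip u v uO vO) _; rewrite mul1r.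
    by case/andP: (equiv u v uO vO).
  apply: le_trans (mean_diff_le_W1 g0 Kd Kd' Koff Koff'' glipH) _.
  by rewrite ler_pM2l// hPhi.
Qed.

End RowBound.

Theorem theorem4p8 (R : realType) (q : nat) (V bV : finType)
    (S : spin_system R q V bV)
    (P : chains R q V) (d : config q V -> config q V -> R)
    (kappa Phi gamma : R)
    (hq : (2 <= q)%N)
    (hOmega : exists s, s \in Omega S)
    (hconn : totally_connected S)
    (hP : chain_collection S P)
    (hPhi : local_collection S Phi P)
    (hd : metric_on (Omega S) d)
    (hgamma : 1 <= gamma)
    (hequiv : hamming_equivalent S gamma d)
    (hkappa : 0 < kappa < 1)
    (hcontr : contractive S kappa P d) :
  spectrally_independent S (2 * gamma ^+ 2 * Phi / (1 - kappa)).
Proof.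
move=> tau ptau lambda; apply: eigenvalue_le_row_sum => i.
have := enum_valP i; case Ei: (enum_val i) => [x a] xaX.
under eq_bigr do rewrite mxE Ei.
rewrite -(big_enum_val (fun p => `|influence S tau (x, a) p|)).
exact: influence_row_le hP hPhi hgamma hequiv hkappa hcontr ptau xaX.
Qed.
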